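(* Let $\langle\phi,\vec{a}\rangle$ be a loop. If $\langle \vec{x}'=\vec{a}^n(\vec{x}) \mid \mathit{true} \mid \phi(\vec{x})\rangle_{\vec{a}} \leadsto^* \langle \psi(\vec{y}) \mid \check\phi(\vec{x}) \mid \mathit{true}\rangle_{\vec{a}}$, then $\psi$ approximates $\langle\phi,\vec{a}\rangle$. If $\langle \vec{x}'=\vec{a}^n(\vec{x}) \mid \mathit{true} \mid \phi(\vec{x})\rangle_{\vec{a}} \leadsto_e^* \langle \psi(\vec{y}) \mid \check\phi(\vec{x}) \mid \mathit{true}\rangle_{\vec{a}}$, then $\psi$ is equivalent to $\langle\phi,\vec{a}\rangle$.
   Context: Fix $d \ge 1$, integer-valued variables $\vec{x}=(x_1,\dots,x_d)$, a variable $n$, and primed variables $\vec{x}'$; write $\vec{y}=(\vec{x},n,\vec{x}')$. $\vec{a}^n$ denotes $n$-fold application of $\vec{a}$ ($\vec{a}^0=\mathrm{id}$). Formulas are finite quantifier-free propositional formulas with atoms $p>0$, $p$ a closed-form arithmetic expression; formulas are in CNF and identified with their sets of clauses ($\cup$ = conjunction, $\setminus$ = clause removal). A loop $\langle \phi,\vec{a}\rangle$ consists of a formula $\phi$ over $\vec{x}$ and $\vec{a}:\mathbb{Z}^d\to\mathbb{Z}^d$ given by closed-form expressions; $\vec{x}\longrightarrow_{\langle\phi,\vec{a}\rangle}\vec{x}'$ iff $\phi(\vec{x})\land\vec{x}'=\vec{a}(\vec{x})$, and $\longrightarrow^n$ is the $n$-fold composition. A formula $\psi$ over $\vec{y}$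 approximates the loop if for all $n>0$, $\vec{x},\vec{x}'\in\mathbb{Z}^d$: $\psi\implies \vec{x}\longrightarrow^n_{\langle\phi,\vec{a}\rangle}\vec{x}'$; it is equivalent to the loop if $\psi\iff \vec{x}\longrightarrow^n_{\langle\phi,\vec{a}\rangle}\vec{x}'$ for all $n>0$. A conditional acceleration technique is a partial function $\mathit{accel}$ from pairs (loop $\langle\chi,\vec{a}\rangle$, formula $\check\phi$ over $\vec{x}$) to formulas over $\vec{y}$; it is sound if for all arguments in its domain, all $\vec{x},\vec{x}'$ and $n>0$, $\vec{x}\longrightarrow^n_{\langle\check\phi,\vec{a}\rangle}\vec{x}'\land\mathit{accel}(\langle\chi,\vec{a}\rangle,\check\phi)$ implies $\vec{x}\longrightarrow^n_{\langle\chi,\vec{a}\rangle}\vec{x}'$, and exact if moreover $\vec{x}\longrightarrow^n_{\langle\chi\land\check\phi,\vec{a}\rangle}\vec{x}'$ implies $\mathit{accel}(\langle\chi,\vec{a}\rangle,\check\phi)$. An acceleration problem is a tuple $\langle \psi \mid \check\phi \mid \hat\phi\rangle_{\vec{a}}$ ($\psi$ over $\vec{y}$; $\check\phi,\hat\phi$ over $\vec{x}$). The relation $\leadsto$: $\langle \psi_1 \mid \check\phi \mid \hat\phi\rangle_{\vec{a}} \leadsto \langle \psi_1\cup\psi_2 \mid \check\phi\cup\chi \mid \hat\phi\setminus\chi\rangle_{\vec{a}}$ whenever $\emptyset\ne\chi\subseteq\hat\phi$ and $\mathit{accel}(\langle\chi,\vec{a}\rangle,\check\phi)=\psi_2$ for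 a sound conditional acceleration technique $\mathit{accel}$; the step is written $\leadsto_e$ if $\mathit{accel}$ is exact. $\leadsto^*$, $\leadsto_e^*$ denote reflexive-transitive closures. *)

(* Defs.v *)
From HB Require Import structures.
From Stdlib Require Import Relation_Operators.
From mathcomp Require Import all_boot all_order all_algebra.
From mathcomp Require Import finmap.

Set Implicit Arguments.
Unset Strict Implicit.
Unset Printing Implicit Defensive.

Import Order.TTheory GRing.Theory Num.Theory.
Local Open Scope ring_scope.
Local Open Scope fset_scope.

(* There is no canonical notion of closed form.  Expressions are built from
   variables, integer constants, +, -, * and the symbols of an arbitrary
   interpreted signature, which provides division, exponentiation and whatever
   else closed forms may use.  Values lie in an arbitrary ordered domain R
   rather than in int, so that R may be a field.  Interpretations are total:
   a partial operation such as division is given arbitrary values outside its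
   domain. *)
Record signature (R : realDomainType) := Signature {
  symbol : choiceType;
  arity : symbol -> nat;
  interp : forall f : symbol, {ffun 'I_(arity f) -> R} -> R
}.

Section Expressions.
Variables (R : realDomainType) (Sg : signature R).

Inductive expr (V : Type) : Type :=
| EVar of V
| EConst of int
| EAdd of expr V & expr V
| ESub of expr V & expr V
| EMul of expr V & expr V
| EApp (f : symbol Sg) of {ffun 'I_(arity f) -> expr V}.

Fixpoint eval (V : Type) (v : V -> int) (e : expr V) : R :=
  match e with
  | EVar x => (v x)%:~R
  | EConst z => z%:~R
  | EAdd e1 e2 => eval v e1 + eval v e2
  | ESub e1 e2 => eval v e1 - eval v e2
  | EMul e1 e2 => eval v e1 * eval v e2
  | EApp f args => interp [ffun i => eval v (args i)]
  end.

Section ExprChoice.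
Variable V : choiceType.

Local Notation code := (GenTree.tree (V + int + symbol Sg)%type).

Fixpoint expr_encode (e : expr V) : code :=
  match e with
  | EVar x => GenTree.Leaf (inl (inl x))
  | EConst z => GenTree.Leaf (inl (inr z))
  | EAdd e1 e2 => GenTree.Node 0 [:: expr_encode e1; expr_encode e2]
  | ESub e1 e2 => GenTree.Node 1 [:: expr_encode e1; expr_encode e2]
  | EMul e1 e2 => GenTree.Node 2 [:: expr_encode e1; expr_encode e2]
  | EApp f args => GenTree.Node 3
      (GenTree.Leaf (inr f)
         :: [seq expr_encode (args i) | i <- enum 'I_(arity f)])
  end.

Fixpoint expr_decode (t : code) : expr V :=
  match t with
  | GenTree.Leaf (inl (inl x)) => EVar x
  | GenTree.Leaf (inl (inr z)) => EConst V z
  | GenTree.Node 0 [:: t1; t2] => EAdd (expr_decode t1) (expr_decode t2)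
  | GenTree.Node 1 [:: t1; t2] => ESub (expr_decode t1) (expr_decode t2)
  | GenTree.Node 2 [:: t1; t2] => EMul (expr_decode t1) (expr_decode t2)
  | GenTree.Node 3 (GenTree.Leaf (inr f) :: ts) =>
      EApp [ffun i : 'I_(arity f) => nth (EConst V 0) (map expr_decode ts) i]
  | _ => EConst V 0
  end.

Lemma expr_encodeK : cancel expr_encode expr_decode.
Proof.
rewrite /cancel; fix IH 1 => -[x|z|e1 e2|e1 e2|e1 e2|f args] /=.
- by [].
- by [].
- by rewrite !IH.
- by rewrite !IH.
- by rewrite !IH.
- congr EApp; apply/ffunP => i; rewrite ffunE -map_comp.
  by rewrite (nth_map i) ?size_enum_ord //= nth_ord_enum IH.
Qed.

HB.instance Definition _ := Choice.copy (expr V) (can_type expr_encodeK).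

End ExprChoice.

(* The literal (b, p) is the atom p > 0 if b is true and its negation
   otherwise. *)
Definition literal (V : choiceType) : choiceType := (bool * expr V)%type.
Definition clause (V : choiceType) : choiceType := seq (literal V).
Definition formula (V : choiceType) := {fset clause V}.

Definition literal_holds (V : choiceType) (v : V -> int) (l : literal V) :
  bool := (0 < eval v l.2) == l.1.

Definition clause_holds (V : choiceType) (v : V -> int) (c : clause V) :
  bool := has (literal_holds v) c.

Definition holds (V : choiceType) (v : V -> int) (phi : formula V) : Prop :=
  forall c, c \in phi -> clause_holds v c.

Definition ftrue (V : choiceType) : formula V := fset0.

Section Loops.
Variable d : nat.

Definition state := 'rV[int]_d.

(* The variables y = (x, n, x'). *)
Definition yvar : choiceType := ('I_d + unit + 'I_d)%type.
Definition var_x (i : 'I_d) : yvar := inl (inl i).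
Definition var_n : yvar := inl (inr tt).
Definition var_x' (i : 'I_d) : yvar := inr i.

Definition xval (x : state) (i : 'I_d) : int := x ord0 i.
Definition yval (x : state) (n : nat) (x' : state) (v : yvar) : int :=
  match v with
  | inl (inl i) => x ord0 i
  | inl (inr _) => n%:Z
  | inr i => x' ord0 i
  end.

Record update := Update {
  upd_expr : 'I_d -> expr 'I_d;
  upd_fun :> state -> state;
  upd_exprE : forall (x : state) (i : 'I_d),
    eval (xval x) (upd_expr i) = (upd_fun x ord0 i)%:~R
}.

Record loop := Loop { guard : formula 'I_d; loop_update : update }.

Definition loop_step (L : loop) (x x' : state) : Prop :=
  holds (xval x) (guard L) /\ x' = loop_update L x.

Fixpoint loop_steps (L : loop) (n : nat) (x x' : state) : Prop :=
  match n with
  | 0%N => x = x'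
  | m.+1 => exists2 z, loop_step L x z & loop_steps L m z x'
  end.

Definition approximates (psi : formula yvar) (L : loop) : Prop :=
  forall (n : nat) (x x' : state), (0 < n)%N ->
    holds (yval x n x') psi -> loop_steps L n x x'.

Definition equivalent (psi : formula yvar) (L : loop) : Prop :=
  forall (n : nat) (x x' : state), (0 < n)%N ->
    (holds (yval x n x') psi <-> loop_steps L n x x').

(* None means that the technique is undefined on the given arguments. *)
Definition technique := loop -> formula 'I_d -> option (formula yvar).

Definition sound (accel : technique) : Prop :=
  forall chi a phi1 psi, accel (Loop chi a) phi1 = Some psi ->
  forall (x x' : state) (n : nat), (0 < n)%N ->
    loop_steps (Loop phi1 a) n x x' -> holds (yval x n x') psi ->
    loop_steps (Loop chi a) n x x'.

Definition exact (accel : technique) : Prop :=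
  sound accel /\
  forall chi a phi1 psi, accel (Loop chi a) phi1 = Some psi ->
  forall (x x' : state) (n : nat), (0 < n)%N ->
    loop_steps (Loop (chi `|` phi1) a) n x x' -> holds (yval x n x') psi.

Record problem := Problem {
  result : formula yvar;
  processed : formula 'I_d;
  remaining : formula 'I_d;
  prob_update : update
}.

Inductive calculus_step (admissible : technique -> Prop) :
    problem -> problem -> Prop :=
| CalculusStep accel psi1 psi2 phi1 phi2 chi a :
    admissible accel -> chi != fset0 -> chi `<=` phi2 ->
    accel (Loop chi a) phi1 = Some psi2 ->
    calculus_step admissible
      (Problem psi1 phi1 phi2 a)
      (Problem (psi1 `|` psi2) (phi1 `|` chi) (phi2 `\` chi) a).

Definition leadsto := calculus_step sound.
Definition leadsto_exact := calculus_step exact.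

Definition leadsto_star := clos_refl_trans problem leadsto.
Definition leadsto_exact_star := clos_refl_trans problem leadsto_exact.

(* The expressions an over y are a closed form of the n-fold application
   of a; only the values at n > 0 matter. *)
Definition closed_form (a : update) (an : 'I_d -> expr yvar) : Prop :=
  forall (n : nat) (x x' : state) (i : 'I_d), (0 < n)%N ->
    eval (yval x n x') (an i) = (iter n a x ord0 i)%:~R.

(* The formula x' = an.  As atoms are strict inequalities p > 0, each equation
   s = t becomes the two unit clauses ~ (s - t > 0) and ~ (t - s > 0). *)
Definition eq_formula (an : 'I_d -> expr yvar) : formula yvar :=
  seq_fset tt
    ([seq [:: (false, ESub (EVar (var_x' i)) (an i))] | i <- enum 'I_d] ++
     [seq [:: (false, ESub (an i) (EVar (var_x' i)))] | i <- enum 'I_d]).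

End Loops.
End Expressions.

(* Main.v *)
(** A [n]-step run of [<phi, a>] from [x] to [x'] exists iff [x' = a^n(x)] and
    [phi] holds along the first [n] iterates, so running under a conjunction
    of guards is the same as running under each of them.  Hence every step of
    the calculus preserves the invariant that the first component approximates
    (for exact steps: is equivalent to) the loop guarded by the second one,
    while the conjunction of the second and third components stays [phi].
    Initially the second component is [true], finally the third one is. *)
Require Import Defs.
From Stdlib Require Import Relation_Operators.
From mathcomp Require Import all_boot all_order all_algebra.
From mathcomp Require Import finmap.

Set Implicit Arguments.
Unset Strict Implicit.
Unset Printing Implicit Defensive.

Import Order.TTheory GRing.Theory Num.Theory.
Local Open Scope ring_scope.
Local Open Scope fset_scope.

Section Calculus.
Variables (R : realDomainType) (Sg : signature R).

Lemma holdsU (V : choiceType) (v : V -> int) (phi psi : formula Sg V) :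
  holds v (phi `|` psi) <-> holds v phi /\ holds v psi.
Proof.
split=> [h|[hphi hpsi] c]; last first.
  by case/fsetUP => [/hphi|/hpsi].
by split=> c hc; apply: h; apply/fsetUP; [left | right].
Qed.

Lemma holds_true (V : choiceType) (v : V -> int) : holds v (ftrue Sg V).
Proof. by move=> c; rewrite in_fset0. Qed.

Variable d : nat.
Implicit Types (phi chi : formula Sg 'I_d) (a : update Sg d) (x : state d).

(** Since the update is a function, the intermediate states that [loop_steps] quantifies can only be
    iterates of [a]. This makes runs pointwise in the guard. *)
Lemma loop_stepsP phi a n x x' :
  loop_steps (Loop phi a) n x x' <->
  x' = iter n a x /\ forall k, (k < n)%N -> holds (xval (iter k a x)) phi.
Proof.
elim: n x => [|n IHn] x /=; first by split=> [->|[]].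
split=> [[_ [/= hx ->] /IHn[-> hk]]|[def_x' hk]].
  (* Index [0] is the guard at [x] itself; index [k.+1] of this run is index [k] of the run from
     [a x]. *)
  split=> [|[|k] //= lt_kn]; first by rewrite -iterSr.
  by rewrite -iterS iterSr; apply: hk.
exists (a x); first by split=> //=; apply: (hk 0%N).
apply/IHn; split=> [|k lt_kn]; first by rewrite -iterSr.
by rewrite -iterSr; apply: hk.
Qed.

Lemma loop_stepsU phi chi a n x x' :
  loop_steps (Loop (phi `|` chi) a) n x x' <->
  loop_steps (Loop phi a) n x x' /\ loop_steps (Loop chi a) n x x'.
Proof.
rewrite !loop_stepsP; split=> [[-> h]|[[-> h1] [_ h2]]].
  by split; split=> // k /h /holdsU[].
by split=> // k lt_kn; apply/holdsU; split; [apply: h1 | apply: h2].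
Qed.

Lemma eq_formulaP a (an : 'I_d -> expr Sg (yvar d)) n x x' :
  closed_form a an -> (0 < n)%N ->
  holds (yval x n x') (eq_formula an) <-> x' = iter n a x.
Proof.
move=> han n_gt0; split=> [h|-> c].
  (* Integers embed injectively in [R], where the two negated strict inequalities give [<=] in both
     directions. *)
  apply/rowP => i; apply: (@intr_inj R); apply: le_anti.
  have /h : [:: (false, ESub (EVar Sg (var_x' i)) (an i))] \in eq_formula an.
    by rewrite seq_fsetE mem_cat map_f // mem_enum.
  have /h : [:: (false, ESub (an i) (EVar Sg (var_x' i)))] \in eq_formula an.
    by rewrite seq_fsetE mem_cat orbC map_f // mem_enum.
  rewrite /clause_holds /= /literal_holds /= !orbF !eqbF_neg han //.
  by rewrite !subr_gt0 -!leNgt => -> ->.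
rewrite seq_fsetE mem_cat => /orP[]/mapP[i _ ->];
  rewrite /clause_holds /= /literal_holds /= orbF eqbF_neg han //;
  by rewrite subrr ltxx.
Qed.

Lemma eq_formula_equivalent a (an : 'I_d -> expr Sg (yvar d)) :
  closed_form a an -> equivalent (eq_formula an) (Loop (ftrue Sg 'I_d) a).
Proof.
move=> han n x x' n_gt0; rewrite (eq_formulaP _ _ han) // loop_stepsP.
by split=> [->|[]//]; split=> // k _; apply: holds_true.
Qed.

Lemma equivalent_approximates (psi : formula Sg (yvar d)) L :
  equivalent psi L -> approximates psi L.
Proof. by move=> h n x x' n_gt0 /h; apply. Qed.

(** Leaving [adm] abstract lets one induction serve both sound and exact derivations. *)
Lemma calculus_star_invariant (adm : technique Sg d -> Prop)
    (I : problem Sg d -> Prop) p q :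
  (forall p1 p2, calculus_step adm p1 p2 -> I p1 -> I p2) ->
  clos_refl_trans _ (calculus_step adm) p q -> I p -> I q.
Proof.
move=> hI; elim=> [p1 p2|//|p1 p2 p3 _ IH1 _ IH2 /IH1 /IH2 //].
exact: hI.
Qed.

(** A step moves [chi] from the third component to the second, and [chi] being contained in the
    third means that no clause appears or disappears. *)
Lemma calculus_star_guard (adm : technique Sg d -> Prop) p q :
  clos_refl_trans _ (calculus_step adm) p q ->
  processed q `|` remaining q = processed p `|` remaining p.
Proof.
move=> pq; pose I r :=
  processed r `|` remaining r = processed p `|` remaining p.
apply: (calculus_star_invariant (I := I) _ pq) => // _ _ [] {pq}.
rewrite /I /= => _ _ _ phi1 phi2 chi _ _ _ le_chi _ <-.
by rewrite -fsetUA fsetUDl fsetDv fsetD0 (fsetUidPr _ _ le_chi).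
Qed.

Definition result_approximates (p : problem Sg d) :=
  approximates (result p) (Loop (processed p) (prob_update p)).

Definition result_equivalent (p : problem Sg d) :=
  equivalent (result p) (Loop (processed p) (prob_update p)).

Lemma leadsto_approximates p q :
  leadsto p q -> result_approximates p -> result_approximates q.
Proof.
case=> accel psi1 psi2 phi1 phi2 chi a snd _ _ acc happ n x x' n_gt0 /=.
case/holdsU => /(happ _ _ _ n_gt0) run1 hpsi2; apply/loop_stepsU; split=> //.
(* Soundness is conditional on a run under [phi1], which is what the invariant extracts from
   [psi1]. *)
exact: snd acc _ _ _ n_gt0 run1 hpsi2.
Qed.

Lemma leadsto_exact_leadsto (p q : problem Sg d) :
  leadsto_exact p q -> leadsto p q.
Proof.
by case=> accel psi1 psi2 phi1 phi2 chi a [snd _]; apply: CalculusStep.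
Qed.

Lemma leadsto_exact_equivalent p q :
  leadsto_exact p q -> result_equivalent p -> result_equivalent q.
Proof.
move=> step heq n x x' n_gt0; split.
  apply: leadsto_approximates (leadsto_exact_leadsto step) _ _ _ _ n_gt0.
  exact: equivalent_approximates.
case: step heq => accel psi1 psi2 phi1 phi2 chi a [_ ex] _ _ acc heq /= run.
(* Exactness yields [psi2] from the whole run; [fsetUC] is needed because [exact] lists [chi] before
   [phi1]. For [psi1], the run is weakened to the guard [phi1]. *)
apply/holdsU; split; last by apply: ex acc _ _ _ n_gt0 _; rewrite fsetUC.
by apply/heq => //; case/loop_stepsU: run.
Qed.

End Calculus.

Theorem theorem5 (R : realDomainType) (Sg : signature R) (d : nat)
    (hd : (0 < d)%N) (phi : formula Sg 'I_d) (a : update Sg d)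
    (an : 'I_d -> expr Sg (yvar d)) (han : closed_form a an) :
  (forall (psi : formula Sg (yvar d)) (phi1 : formula Sg 'I_d),
     leadsto_star (Problem (eq_formula an) (ftrue Sg 'I_d) phi a)
                  (Problem psi phi1 (ftrue Sg 'I_d) a) ->
     approximates psi (Loop phi a)) /\
  (forall (psi : formula Sg (yvar d)) (phi1 : formula Sg 'I_d),
     leadsto_exact_star (Problem (eq_formula an) (ftrue Sg 'I_d) phi a)
                        (Problem psi phi1 (ftrue Sg 'I_d) a) ->
     equivalent psi (Loop phi a)).
Proof.
have init := eq_formula_equivalent han.
split=> psi phi1 star; have := calculus_star_guard star;
  (* The second component is empty at the start and the third at the end, so the final [phi1] is
     [phi]. *)
  rewrite /= fsetU0 fset0U => eq_phi1; rewrite -{}eq_phi1 in star *.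
  apply: (calculus_star_invariant (@leadsto_approximates _ _ _) star).
  exact: equivalent_approximates.
exact: (calculus_star_invariant (@leadsto_exact_equivalent _ _ _) star).
Qed.
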